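(* Let $\mathbf{S}$ be a transformation semigroup over a set $X$ whose set $\mathcal{S}(\mathbf{S})$ of unrepresentations is non-empty. Then the unrepresentations of $\mathbf{S}$ form a group (with the group structure determined by any choice of a distinguished unrepresentation $e$) isomorphic to the group of invertible elements of the centralizer of $\mathbf{S}$ in $\mathrm{End}(X)$.
   Context: $\mathrm{End}(X)$ is the monoid of all functions $X\to X$ under composition; a transformation semigroup over $X$ is a subsemigroup $\mathbf{S}$ (with underlying set $S$) of it. For a semigroup $\mathbf{X}=(X,\cdot)$ the representing map is $\phi_{\mathbf{X}}(x)(y)=x\cdot y$; its image in $\mathrm{End}(X)$ is the representation of $\mathbf{X}$, and $\mathbf{X}$ is faithful if $\phi_{\mathbf{X}}$ is injective. An unrepresentation of $\mathbf{S}$ is a faithful semigroup with underlying set $X$ whose representation is $\mathbf{S}$; $\mathcal{S}(\mathbf{S})$ is the set of these. It is identified, via $\mathbf{X}\mapsto\phi_{\mathbf{X}}$, with the set $\mathrm{Iso}(\epsilon,\circ)$ of bijections $\phi\colon X\to S$ satisfying $\phi(f(x))=f\circ\phi(x)$ for all $f\in S$, $x\in X$. Fixing $e\in\mathrm{Iso}(\epsilon,\circ)$, the group structure on this set is $f\cdot g=f e^{-1} g$ (composition of maps), with identity $e$. The centralizer of $\mathbf{S}$ in $\mathrm{End}(X)$ is the monoid of all $h\in\mathrm{End}(X)$ with $h\circ f=f\circ h$ for all $f\in S$. *)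

(* Defs.v *)
From HB Require Import structures.
From mathcomp Require Import all_boot monoid.
From mathcomp Require Import boolp classical_sets.

Set Implicit Arguments.
Unset Strict Implicit.
Unset Printing Implicit Defensive.

Local Open Scope group_scope.

Definition End (X : Type) : Type := X -> X.

HB.instance Definition _ (X : Type) := gen_eqMixin (End X).
HB.instance Definition _ (X : Type) := gen_choiceMixin (End X).

Section EndMonoid.
Variable X : Type.
Implicit Types f g h : End X.

Definition End_one : End X := id.
Definition End_mul f g : End X := f \o g.

Lemma End_mulA : associative End_mul. Proof. by []. Qed.
Lemma End_mul1 : left_id End_one End_mul. Proof. by []. Qed.
Lemma End_mulr1 : right_id End_one End_mul. Proof. by []. Qed.

HB.instance Definition _ := isMonoid.Build (End X) End_mulA End_mul1 End_mulr1.
End EndMonoid.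

Record centralizer (M : monoidType) (A : set M) := Centralizer {
  centralizer_val : M;
  centralizerP : forall a, A a -> commute centralizer_val a }.

HB.instance Definition _ M A := gen_eqMixin (@centralizer M A).
HB.instance Definition _ M A := gen_choiceMixin (@centralizer M A).

Section CentralizerMonoid.
Variables (M : monoidType) (A : set M).
Implicit Types x y : centralizer A.

Lemma centralizer_inj : injective (@centralizer_val M A).
Proof.
by move=> [x hx] [y hy] /= exy; subst y; rewrite (Prop_irrelevance hx hy).
Qed.

Lemma centralizer_one_subproof a : A a -> commute (1 : M) a.
Proof. by move=> _; rewrite /commute mul1g mulg1. Qed.

Lemma centralizer_mul_subproof x y a : A a -> commute (centralizer_val x * centralizer_val y) a.
Proof.
move=> Aa; rewrite /commute -mulgA (centralizerP y Aa) !mulgA.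
by rewrite (centralizerP x Aa).
Qed.

Definition centralizer_one := Centralizer centralizer_one_subproof.
Definition centralizer_mul x y := Centralizer (@centralizer_mul_subproof x y).

Lemma centralizer_mulA : associative centralizer_mul.
Proof. by move=> x y z; apply: centralizer_inj; rewrite /= mulgA. Qed.
Lemma centralizer_mul1 : left_id centralizer_one centralizer_mul.
Proof. by move=> x; apply: centralizer_inj; rewrite /= mul1g. Qed.
Lemma centralizer_mulr1 : right_id centralizer_one centralizer_mul.
Proof. by move=> x; apply: centralizer_inj; rewrite /= mulg1. Qed.

HB.instance Definition _ := isMonoid.Build (centralizer A)
  centralizer_mulA centralizer_mul1 centralizer_mulr1.
End CentralizerMonoid.

Definition invertible (M : monoidType) (x : M) : Prop :=
  exists y : M, y * x = 1 /\ x * y = 1.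

Record units (M : monoidType) := Units {
  units_val : M;
  unitsP : invertible units_val }.

HB.instance Definition _ M := gen_eqMixin (units M).
HB.instance Definition _ M := gen_choiceMixin (units M).

Section UnitsGroup.
Variable M : monoidType.
Implicit Types x y : units M.

Lemma units_inj : injective (@units_val M).
Proof.
by move=> [x hx] [y hy] /= exy; subst y; rewrite (Prop_irrelevance hx hy).
Qed.

Lemma units_one_subproof : invertible (1 : M).
Proof. by exists 1; rewrite mul1g. Qed.

Lemma units_mul_subproof x y : invertible (units_val x * units_val y).
Proof.
case: (unitsP x) (unitsP y) => x' [x'x xx'] [y' [y'y yy']].
exists (y' * x'); split.
  by rewrite -mulgA (mulgA x') x'x mul1g.
by rewrite -mulgA (mulgA (units_val y)) yy' mul1g.
Qed.

Definition units_inv_val x : M := projT1 (cid (unitsP x)).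

Lemma units_mulVval x : units_inv_val x * units_val x = 1.
Proof. by rewrite /units_inv_val; case: cid => y []. Qed.

Lemma units_mulvalV x : units_val x * units_inv_val x = 1.
Proof. by rewrite /units_inv_val; case: cid => y []. Qed.

Lemma units_inv_subproof x : invertible (units_inv_val x).
Proof.
by exists (units_val x); split; [exact: units_mulvalV | exact: units_mulVval].
Qed.

Definition units_one := Units units_one_subproof.
Definition units_mul x y := Units (units_mul_subproof x y).
Definition units_inv x := Units (units_inv_subproof x).

Lemma units_mulA : associative units_mul.
Proof. by move=> x y z; apply: units_inj; rewrite /= mulgA. Qed.
Lemma units_mul1 : left_id units_one units_mul.
Proof. by move=> x; apply: units_inj; rewrite /= mul1g. Qed.
Lemma units_mulr1 : right_id units_one units_mul.
Proof. by move=> x; apply: units_inj; rewrite /= mulg1. Qed.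
Lemma units_mulV : left_inverse units_one units_inv units_mul.
Proof. by move=> x; apply: units_inj; exact: units_mulVval. Qed.
Lemma units_mulrV : right_inverse units_one units_inv units_mul.
Proof. by move=> x; apply: units_inj; exact: units_mulvalV. Qed.

HB.instance Definition _ := isGroup.Build (units M)
  units_mulA units_mul1 units_mulr1 units_mulV units_mulrV.
End UnitsGroup.

Record trans_semigroup (X : Type) := TransSemigroup {
  trans_set : set (End X);
  trans_closed : forall f g, trans_set f -> trans_set g -> trans_set (f * g) }.

(* A semigroup structure on the bare type X.  MathComp's semigroupType also
   bundles a choice operator on the carrier, so two semigroups with the same
   multiplication could differ as structures; here they are equal. *)
Record semigroup_on (X : Type) := SemigroupOn {
  sg_mul : X -> X -> X;
  sg_mulA : associative sg_mul }.

Definition representing_map (X : Type) (A : semigroup_on X) (x : X) : End X :=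
  fun y => sg_mul A x y.

Definition representation (X : Type) (A : semigroup_on X) : set (End X) :=
  range (representing_map A).

Definition faithful (X : Type) (A : semigroup_on X) : Prop :=
  injective (representing_map A).

Record unrepresentation (X : Type) (S : trans_semigroup X) := Unrepresentation {
  unrep_semigroup :> semigroup_on X;
  unrep_faithful : faithful unrep_semigroup;
  unrep_representation : representation unrep_semigroup = trans_set S }.

Definition elt (X : Type) (S : trans_semigroup X) : Type := {f : End X | trans_set S f}.

Record iso (X : Type) (S : trans_semigroup X) := Iso {
  iso_fun :> X -> elt S;
  iso_bij : bijective iso_fun;
  iso_equiv : forall (f : elt S) (x : X),
    sval (iso_fun (sval f x)) = sval f \o sval (iso_fun x) }.

Section UnrepresentationIso.
Variables (X : Type) (S : trans_semigroup X).
Implicit Types (A B : unrepresentation S) (e f g : iso S).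

Lemma elt_inj : injective (sval : elt S -> End X).
Proof.
by move=> [f hf] [g hg] /= efg; subst g; rewrite (Prop_irrelevance hf hg).
Qed.

Lemma unrep_inj A B : sg_mul A = sg_mul B -> A = B.
Proof.
case: A B => [[a ha] fA rA] [[b hb] fB rB] /= eab; subst b.
have eh := Prop_irrelevance ha hb; subst hb.
by rewrite (Prop_irrelevance fA fB) (Prop_irrelevance rA rB).
Qed.

Lemma iso_inj f g : iso_fun f = iso_fun g -> f = g.
Proof.
case: f g => [f bf ef] [g bg eg] /= efg; subst g.
by rewrite (Prop_irrelevance bf bg) (Prop_irrelevance ef eg).
Qed.

Lemma iso_of_unrep_in A x : trans_set S (representing_map A x).
Proof. by rewrite -(unrep_representation A); exists x. Qed.

Definition iso_of_unrep_fun A (x : X) : elt S :=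
  exist _ (representing_map A x) (iso_of_unrep_in A x).

Lemma iso_of_unrep_bij A : bijective (iso_of_unrep_fun A).
Proof.
have surj (f : elt S) : exists x, iso_of_unrep_fun A x = f.
  have : representation A (sval f).
    by rewrite (unrep_representation A); exact: (svalP f).
  by case=> x _ xf; exists x; apply: elt_inj.
exists (fun s => projT1 (cid (surj s))) => [x|s]; case: cid => //= y.
by move=> /(congr1 sval); exact: (@unrep_faithful _ _ A).
Qed.

Lemma iso_of_unrep_equiv A (f : elt S) x :
  sval (iso_of_unrep_fun A (sval f x)) = sval f \o sval (iso_of_unrep_fun A x).
Proof.
have : representation A (sval f).
  by rewrite (unrep_representation A); exact: (svalP f).
case=> z _ <-.
by apply/funext => y /=; rewrite /representing_map -sg_mulA.
Qed.

Definition iso_of_unrep A : iso S :=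
  Iso (iso_of_unrep_bij A) (iso_of_unrep_equiv A).

Definition unrep_of_iso_mul f (x y : X) : X := sval (f x) y.

Lemma unrep_of_iso_mulA f : associative (unrep_of_iso_mul f).
Proof. by move=> x y z; rewrite /unrep_of_iso_mul iso_equiv. Qed.

Definition unrep_of_iso_semigroup f := SemigroupOn (unrep_of_iso_mulA f).

Lemma unrep_of_iso_faithful f : faithful (unrep_of_iso_semigroup f).
Proof. by move=> x y /elt_inj; exact: (bij_inj (iso_bij f)). Qed.

Lemma unrep_of_iso_representation f :
  representation (unrep_of_iso_semigroup f) = trans_set S.
Proof.
apply/seteqP; split=> [_ [x _ <-]|h Sh]; first exact: (svalP (f x)).
have [f' _ f'K] := iso_bij f.
exists (f' (exist _ h Sh)) => //.
by have /(congr1 sval) := f'K (exist _ h Sh).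
Qed.

Definition unrep_of_iso f : unrepresentation S :=
  Unrepresentation (@unrep_of_iso_faithful f) (unrep_of_iso_representation f).

Lemma iso_of_unrepK : cancel iso_of_unrep unrep_of_iso.
Proof. by move=> A; apply: unrep_inj. Qed.

Lemma unrep_of_isoK : cancel unrep_of_iso iso_of_unrep.
Proof. by move=> f; apply: iso_inj; apply/funext => x; apply: elt_inj. Qed.

Lemma iso_inv_subproof f : exists f' : elt S -> X, cancel f f' /\ cancel f' f.
Proof. by have [f' fK f'K] := iso_bij f; exists f'. Qed.

Definition iso_inv f : elt S -> X := projT1 (cid (iso_inv_subproof f)).

Lemma iso_invK f : cancel f (iso_inv f).
Proof. by rewrite /iso_inv; case: cid => f' []. Qed.

Lemma iso_funK f : cancel (iso_inv f) f.
Proof. by rewrite /iso_inv; case: cid => f' []. Qed.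

Definition iso_mul_fun e f g : X -> elt S := f \o iso_inv e \o g.

Lemma iso_mul_bij e f g : bijective (iso_mul_fun e f g).
Proof.
apply: bij_comp (iso_bij g); apply: bij_comp (iso_bij f) _.
by exists e; [exact: iso_funK | exact: iso_invK].
Qed.

Lemma iso_mul_equiv e f g (h : elt S) x :
  sval (iso_mul_fun e f g (sval h x)) = sval h \o sval (iso_mul_fun e f g x).
Proof.
rewrite /iso_mul_fun /= -iso_equiv; congr (sval (f _)).
apply: (bij_inj (iso_bij e)); rewrite iso_funK; apply: elt_inj.
by rewrite !iso_equiv iso_funK.
Qed.

Definition iso_mul e f g : iso S :=
  Iso (iso_mul_bij e f g) (iso_mul_equiv e f g).

(* The operation f e^-1 g of iso S, read on unrepresentations through the
   identification A |-> representing_map A. *)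
Definition unrep_mul (E A B : unrepresentation S) : unrepresentation S :=
  unrep_of_iso (iso_mul (iso_of_unrep E) (iso_of_unrep A) (iso_of_unrep B)).

End UnrepresentationIso.

(* Main.v *)
Require Import Defs.
From mathcomp Require Import all_boot monoid.
From mathcomp Require Import boolp classical_sets.

(** In terms of the bijections [X -> S], the isomorphism sends [f] to the
    ratio [e^-1 f], with inverse [h |-> e h]. It turns [f e^-1 g] into the
    composition [(e^-1 f) (e^-1 g)], and the group laws on unrepresentations
    are transported along this bijection from the group of units. *)

Set Implicit Arguments.
Unset Strict Implicit.
Unset Printing Implicit Defensive.

Local Open Scope group_scope.

Section Ratio.
Variables (X : Type) (S : trans_semigroup X).
Implicit Types e f g : iso S.

Definition iso_ratio_val e f : End X := iso_inv e \o f.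

(** By equivariance of [e] and [f], applying [e] to either side at [x] gives [k] composed with
    [f x]; injectivity of [e] concludes. *)
Lemma iso_ratio_commute e f (k : End X) :
  trans_set S k -> commute (iso_ratio_val e f) k.
Proof.
move=> Sk; apply/funext => x; pose k' : elt S := exist _ k Sk.
apply: (bij_inj (iso_bij e)); apply: elt_inj.
(* Writing [k] as [sval k'] exposes the pattern of [iso_equiv], which speaks of elements of
   [elt S]. *)
change (sval (e (iso_inv e (f (sval k' x)))) =
        sval (e (sval k' (iso_inv e (f x))))).
by rewrite iso_funK !iso_equiv iso_funK.
Qed.

Definition iso_ratio e f : centralizer (trans_set S) :=
  Centralizer (@iso_ratio_commute e f).

(** A cocycle rule with varying base point: the inner [f] cancels [iso_inv f]. *)
Lemma iso_ratioM e f g : iso_ratio e f * iso_ratio f g = iso_ratio e g.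
Proof.
apply: centralizer_inj; apply/funext => x.
by congr (iso_inv e _); exact: iso_funK.
Qed.

Lemma iso_ratio1 e : iso_ratio e e = 1.
Proof. by apply: centralizer_inj; apply/funext => x; exact: iso_invK. Qed.

Lemma iso_ratio_mul e f g :
  iso_ratio e (iso_mul e f g) = iso_ratio e f * iso_ratio e g.
Proof. by apply: centralizer_inj. Qed.

(** By the cocycle rule, exchanging the two bijections inverts the ratio. *)
Lemma iso_ratio_invertible e f : invertible (iso_ratio e f).
Proof. by exists (iso_ratio f e); rewrite !iso_ratioM !iso_ratio1. Qed.

Definition iso_ratio_unit e f : units (centralizer (trans_set S)) :=
  Units (iso_ratio_invertible e f).

Section Translate.
Variables (e : iso S) (u : units (centralizer (trans_set S))).

Definition iso_translate_fun : X -> elt S :=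
  e \o centralizer_val (units_val u).

(** An inverse of [u] in the centralizer is also a two-sided inverse of the underlying map on
    [X]. *)
Lemma iso_translate_bij : bijective iso_translate_fun.
Proof.
apply: bij_comp (iso_bij e) _; have [v [vu uv]] := unitsP u.
exists (centralizer_val v) => x.
  by have /(congr1 (fun c => (centralizer_val c : End X) x)) := vu.
by have /(congr1 (fun c => (centralizer_val c : End X) x)) := uv.
Qed.

(** Since [u] commutes with [k], equivariance passes from [e] to [e u]. *)
Lemma iso_translate_equiv (k : elt S) x :
  sval (iso_translate_fun (sval k x)) = sval k \o sval (iso_translate_fun x).
Proof.
rewrite -iso_equiv /iso_translate_fun /=; congr (sval (e _)).
by have /(congr1 (@^~ x)) := centralizerP (units_val u) (svalP k).
Qed.

Definition iso_translate : iso S := Iso iso_translate_bij iso_translate_equiv.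

End Translate.

Lemma iso_ratio_unitK e : cancel (iso_ratio_unit e) (iso_translate e).
Proof. by move=> f; apply: iso_inj; apply/funext => x; exact: iso_funK. Qed.

Lemma iso_translateK e : cancel (iso_translate e) (iso_ratio_unit e).
Proof.
move=> u; apply: units_inj; apply: centralizer_inj; apply/funext => x.
exact: iso_invK.
Qed.

End Ratio.

Theorem theorem3p7 (X : Type) (S : trans_semigroup X)
    (E : unrepresentation S) :
  [/\ associative (unrep_mul E),
      left_id E (unrep_mul E),
      right_id E (unrep_mul E) &
      exists inv : unrepresentation S -> unrepresentation S,
        left_inverse E inv (unrep_mul E) /\
        right_inverse E inv (unrep_mul E)] /\
  exists F : unrepresentation S -> units (centralizer (trans_set S)),
    bijective F /\
    {morph F : A B / unrep_mul E A B >-> (A * B)%g}.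
Proof.
pose F A := iso_ratio_unit (iso_of_unrep E) (iso_of_unrep A).
pose G u := unrep_of_iso (iso_translate (iso_of_unrep E) u).
have FK : cancel F G by move=> A; rewrite /G iso_ratio_unitK iso_of_unrepK.
have GK : cancel G F by move=> u; rewrite /F unrep_of_isoK iso_translateK.
have FM : {morph F : A B / unrep_mul E A B >-> A * B}.
  (* [unrep_mul] ends with [unrep_of_iso], which [F] undoes, leaving the product of bijections. *)
  by move=> A B; apply: units_inj; rewrite /= unrep_of_isoK iso_ratio_mul.
have F1 : F E = 1 by apply: units_inj; exact: iso_ratio1.
have Finj := can_inj FK.
split; last by exists F; split; [exists G|].
split.
- by move=> A B C; apply: Finj; rewrite !FM mulgA.
- by move=> A; apply: Finj; rewrite FM F1 mul1g.
- by move=> A; apply: Finj; rewrite FM F1 mulg1.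
(* If [A] corresponds to the bijection [f], this inverse corresponds to [e f^-1 e]. *)
exists (fun A => G (F A)^-1); split=> A; apply: Finj; rewrite FM GK F1.
  exact: mulVg.
exact: mulgV.
Qed.
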